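(* Let $(a_n)_{n\ge 1}$ be a sequence with $a_n>0$ for all $n$, let $0<p<1$, and let $q$ be defined by $1/p+1/q=1$. Then for any real number $r$ satisfying $(2+r)p\le 1$, $$\sum_{n=1}^{\infty}\Big(\Big(\frac{(n+1)^r-n^r}{r}\Big)\sum_{k=1}^{n}\frac{a_k}{k^r}\Big)^q\ \le\ \Big(\frac{p}{1-rp}\Big)^q\sum_{n=1}^{\infty}a_n^q .$$ The same inequality also holds when $p>1$ and $1/p-2\le r<1/p$, and the reversed inequality (with $\ge$ in place of $\le$) holds when $p<0$ and $1/p-2\le r<1/p$ (with $q$ again defined by $1/p+1/q=1$). In each case the constant $\big(p/(1-rp)\big)^q$ is best possible.
   Context: Convention: for $r=0$ the expression $\frac{(n+1)^r-n^r}{r}$ is interpreted as $\ln\frac{n+1}{n}$. All sums have nonnegative terms and take values in $[0,+\infty]$. ''Best possible'' means that, for the given $p$ and $r$, the constant cannot be replaced by a smaller one (when the inequality is $\le$), respectively by a larger one (when it is $\ge$), so that the inequality still holds for all positive sequences $(a_n)$. *)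

(* Defs.v *)
From mathcomp Require Import all_boot all_order all_algebra.
From mathcomp Require Import all_classical all_reals all_analysis.
Set Implicit Arguments.
Unset Strict Implicit.
Unset Printing Implicit Defensive.
Import Order.TTheory GRing.Theory Num.Theory.
Import numFieldNormedType.Exports.
Local Open Scope ring_scope.

(* Sequences (a_n)_{n >= 1} are functions on nat whose value at 0 is ignored. *)
Definition positive_seq (R : realType) (a : nat -> R) : Prop :=
  forall n : nat, (0 < n)%N -> 0 < a n.

(* The value at r = 0 is the limit of the other expression as r tends to 0. *)
Definition weight (R : realType) (r : R) (n : nat) : R :=
  if r == 0 then ln (n.+1%:R / n%:R)
  else (n.+1%:R `^ r - n%:R `^ r) / r.

Definition weighted_sum (R : realType) (r : R) (a : nat -> R) (n : nat) : R :=
  weight r n * \sum_(1 <= k < n.+1) a k / k%:R `^ r.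

(* On positive sequences every base below is positive, so powR is the usual
   real power also for q < 0, and the series have nonnegative terms. *)
Definition power_series_sum (R : realType) (q : R) (u : nat -> R) : \bar R :=
  (\sum_(1 <= n <oo) (u n `^ q)%:E)%E.

Definition upper_ineq (R : realType) (q r C : R) : Prop :=
  forall a : nat -> R, positive_seq a ->
    (power_series_sum q (weighted_sum r a) <= C%:E * power_series_sum q a)%E.

Definition lower_ineq (R : realType) (q r C : R) : Prop :=
  forall a : nat -> R, positive_seq a ->
    (power_series_sum q (weighted_sum r a) >= C%:E * power_series_sum q a)%E.

Definition best_upper (R : realType) (q r C : R) : Prop :=
  upper_ineq q r C /\ forall C' : R, C' < C -> ~ upper_ineq q r C'.

Definition best_lower (R : realType) (q r C : R) : Prop :=
  lower_ineq q r C /\ forall C' : R, C < C' -> ~ lower_ineq q r C'.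

(* Main.v *)
Require Import Defs.
From mathcomp Require Import all_boot all_order all_algebra.
From mathcomp Require Import all_classical all_reals all_analysis.
From mathcomp Require Import ring lra.
Import Order.TTheory GRing.Theory Num.Theory.
Import numFieldNormedType.Exports.
Local Open Scope ring_scope.

(* With c = 1/p - r > 0 the constant is c^-q, and the extremal behaviour is
   a_n / n^r ~ n^(c - 1). Put S_n = sum_(k <= n) a_k / k^r and
   G_n = sum_(k <= n) k^(c - 1). Since x^q y^(1 - q) is homogeneous and, for
   q > 1 or q < 0, convex, splitting (S_n, G_n) as (S_(n-1), G_(n-1)) +
   (a_n / n^r, n^(c - 1)) gives a_n^q >= n^-c (U_n - U_(n-1)) with
   U_n = S_n^q G_n^(1 - q). Summing by parts, it remains to compare
   n^-c - (n+1)^-c with c^q w_n^q G_n^(q - 1), where w_n is the integral of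
   t^(r - 1) over [n, n+1]. By Hoelder this reduces to the comparison of
   c G_n * (integral of t^-c over [n, n+1]) with 1, an inequality of Levin and
   Stechkin whose direction changes at c = 2, the threshold in the hypotheses.
   For 0 < q < 1 everything is reversed, and the boundary term of the summation
   by parts is absorbed by the tail because U_n increases.
   For optimality, take S_n = n^c for n <= N with a harmless tail: then
   n (A_n^q - C' a_n^q), A_n = w_n S_n, tends to 1 - C' c^q, and the harmonic
   series diverges.
   Every estimate carries a factor e = 1 or -1, so that the convex and the
   concave cases share one proof. *)

(** * Real powers, Bernoulli's inequality and its homogeneous form *)

Lemma le_of_derive_ge0 {R : realType} (F dF : R -> R) (a b : R) :
  a <= b -> (forall x, a <= x <= b -> is_derive x 1 F (dF x)) ->
  (forall x, a <= x <= b -> 0 <= dF x) -> F a <= F b.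
Proof.
move=> ab FdF dF0; have [||c cab FE] := @MVT_segment R F dF a b ab.
- by move=> x; rewrite in_itv /= => /andP[ax xb]; apply: FdF; rewrite !ltW.
- apply: derivable_within_continuous => x; rewrite in_itv /= => xab.
  exact: (@ex_derive _ _ _ _ _ _ _ (FdF x xab)).
- rewrite -subr_ge0 FE mulr_ge0 ?subr_ge0 // dF0 //.
Qed.

Lemma powR_addr {R : realType} (x s t : R) :
  0 < x -> x `^ (s + t) = x `^ s * x `^ t.
Proof. by move=> x0; rewrite powRD // (gt_eqF x0) implybT. Qed.

Lemma powR_subr1 {R : realType} (x s : R) : 0 < x -> x * x `^ (s - 1) = x `^ s.
Proof.
move=> x0; rewrite -[X in X * _](powRr1 (ltW x0)) -powR_addr //.
by congr powR; ring.
Qed.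

Lemma powRVl {R : realType} (x q : R) : 0 < x -> x^-1 `^ q = (x `^ q)^-1.
Proof. by move=> x0; rewrite -powR_inv1 ?ltW // -powRrM mulN1r powRN. Qed.

Lemma powR_divl {R : realType} (x y s : R) :
  0 < x -> 0 < y -> (x / y) `^ s = x `^ s / y `^ s.
Proof.
by move=> x0 y0; rewrite powRM ?invr_ge0 ?ltW // powRVl.
Qed.

Lemma powR_sub1_sign {R : realType} (s x : R) :
  0 < x -> 0 <= s * (x - 1) * (x `^ s - 1).
Proof.
move=> x0; have [x1|x1] := leP 1 x; have [s0|s0] := leP 0 s.
- have : x `^ 0 <= x `^ s by apply: ler_powR.
  by rewrite powRr0 => ?; rewrite !mulr_ge0 ?subr_ge0.
- have : x `^ s <= x `^ 0 by apply: ler_powR => //; exact: ltW.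
  rewrite powRr0 => h; rewrite mulr_le0 ?subr_le0 //.
  by rewrite mulr_le0_ge0 ?subr_ge0 // ltW.
- have : x `^ s <= x `^ 0 by apply: ger_powR; rewrite // x0 ltW.
  rewrite powRr0 => h; rewrite mulr_le0 ?subr_le0 //.
  by rewrite mulr_ge0_le0 ?subr_le0 // ltW.
- have : x `^ 0 <= x `^ s by apply: ger_powR; rewrite ?x0 ltW.
  rewrite powRr0 => h; rewrite mulr_ge0 ?subr_ge0 //.
  by rewrite mulr_le0 ?subr_le0 // ltW.
Qed.

Lemma powR_sub1_ge0 {R : realType} (e s x : R) :
  0 < x -> 0 <= e * s * (x - 1) -> 0 <= e * (x `^ s - 1).
Proof.
move=> x0 h; have := powR_sub1_sign s x x0.
have [->|s0] := eqVneq s 0; first by rewrite powRr0 subrr !mulr0.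
have [->|x1] := eqVneq x 1; first by rewrite powR1 subrr !mulr0.
(* The product of the nonnegative expressions in [h] and [h1] is this square times the goal. *)
move=> h1; have k0 : 0 < (s * (x - 1)) ^+ 2.
  by rewrite exprn_even_gt0 //= mulf_neq0 // subr_eq0.
rewrite -(pmulr_rge0 _ k0); have := mulr_ge0 h h1.
by congr (0 <= _); ring.
Qed.

(** The difference vanishes at 1 and its derivative has the sign of t - 1, so it is minimal at 1. *)
Lemma bernoulli {R : realType} (e q x : R) :
  0 <= e * (q * (q - 1)) -> 0 < x -> 0 <= e * (x `^ q - 1 - q * (x - 1)).
Proof.
move=> eq0 x0.
pose F (t : R) := e * (t `^ q - 1 - q * (t - 1)).
pose dF (t : R) := e * q * (t `^ (q - 1) - 1).
have dFE (t : R) : 0 < t -> is_derive t 1 F (dF t).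
  move=> t0; rewrite /F; have dt := is_derive1_powR q t0.
  apply: is_derive_eq.
  by rewrite /GRing.scale /= /dF; ring.
have dFs (t : R) : 0 < t -> 0 <= (t - 1) * dF t.
  move=> t0; rewrite /dF mulrA; apply: powR_sub1_ge0 => //.
  rewrite (_ : _ * _ = e * (q * (q - 1)) * (t - 1) ^+ 2); last by ring.
  by rewrite mulr_ge0 // sqr_ge0.
have F1 : F 1 = 0 by rewrite /F powR1; ring.
rewrite -/(F x) -F1; have [x1|x1] := leP 1 x.
- apply: (@le_of_derive_ge0 _ F dF) => // t /andP[t1 _].
    by apply: dFE; rewrite (lt_le_trans ltr01).
  have t0 : 0 < t by rewrite (lt_le_trans ltr01).
  have [<-|t1'] := eqVneq 1 t; first by rewrite /dF powR1 subrr mulr0.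
  by have := dFs t t0; rewrite pmulr_rge0 // subr_gt0 lt_neqAle t1'.
- rewrite -lerN2; apply: (@le_of_derive_ge0 _ (fun t => - F t) (fun t => - dF t)).
  + exact: ltW.
  + move=> t /andP[xt _]; have := dFE t (lt_le_trans x0 xt) => h.
    exact: is_deriveN.
  + move=> t /andP[xt t1]; have t0 := lt_le_trans x0 xt.
    have [->|t1'] := eqVneq t 1; first by rewrite /dF powR1 subrr mulr0 oppr0.
    have := dFs t t0; rewrite -mulrNN pmulr_rge0 // oppr_gt0 subr_lt0.
    by rewrite lt_neqAle t1'.
Qed.

(* [z] is the slope at which the homogeneous function [x `^ q * y `^ (1 - q)]
   is linearised. *)
Lemma tangent_homog {R : realType} (e q x y z : R) :
  0 <= e * (q * (q - 1)) -> 0 < x -> 0 < y -> 0 < z ->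
  0 <= e * (x `^ q * y `^ (1 - q) - ((1 - q) * z `^ q * y + q * z `^ (q - 1) * x)).
Proof.
move=> eq0 x0 y0 z0.
(* Bernoulli's inequality at x/(yz), multiplied by y z^q, is the claim. *)
have w0 : 0 < x / (y * z) by rewrite divr_gt0 ?mulr_gt0.
have := bernoulli e q _ eq0 w0.
have -> : x `^ q * y `^ (1 - q) = y * z `^ q * (x / (y * z)) `^ q.
  rewrite powR_divl ?mulr_gt0 // powRM ?ltW // powR_addr // powRr1 ?ltW // powRN.
  by field; rewrite ?gt_eqF ?powR_gt0.
rewrite -(powR_subr1 z q z0); set v := _ `^ q => h.
have zq : 0 < z `^ (q - 1) by rewrite powR_gt0.
rewrite (_ : e * _ = (y * z * z `^ (q - 1)) * (e * (v - 1 - q * (x / (y * z) - 1)))).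
  by rewrite mulr_ge0 // !mulr_ge0 // ltW.
by field; rewrite ?gt_eqF ?mulr_gt0.
Qed.

(** The tangent of slope [(T + d) / (G + g)] is exact at the sum of the two points; adding the
    tangent bounds at (T, G) and (d, g) gives the result. *)
Lemma superadd_homog {R : realType} (e q T G d g : R) :
  0 <= e * (q * (q - 1)) -> 0 < T -> 0 < G -> 0 < d -> 0 < g ->
  0 <= e * (d `^ q * g `^ (1 - q) -
    ((T + d) `^ q * (G + g) `^ (1 - q) - T `^ q * G `^ (1 - q))).
Proof.
move=> eq0 T0 G0 d0 g0; have Td : 0 < T + d by rewrite addr_gt0.
have Gg : 0 < G + g by rewrite addr_gt0.
have z0 : 0 < (T + d) / (G + g) by rewrite divr_gt0.
have := tangent_homog e q _ _ _ eq0 T0 G0 z0.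
have := tangent_homog e q _ _ _ eq0 d0 g0 z0.
have <- : (1 - q) * ((T + d) / (G + g)) `^ q * (G + g) +
   q * ((T + d) / (G + g)) `^ (q - 1) * (T + d) =
   (T + d) `^ q * (G + g) `^ (1 - q).
  rewrite -(powR_subr1 _ q z0) powR_divl // powR_addr // (powR_addr (G + g)) //.
  rewrite [X in _ = _ * X]powR_addr // !powRN !powRr1 ?ltW //.
  by field; rewrite ?gt_eqF ?powR_gt0.
lra.
Qed.

(** * Integrals of powers *)

(* [powint s x] is the integral of [t `^ (s - 1)] between [1] and [x]. *)
Definition powint {R : realType} (s x : R) : R :=
  if s == 0 then ln x else (x `^ s - 1) / s.

Lemma is_derive_powint {R : realType} (s x : R) :
  0 < x -> is_derive x 1 (powint s) (x `^ (s - 1)).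
Proof.
move=> x0; rewrite /powint; have [->|s0] := eqVneq s 0.
  rewrite sub0r powR_inv1 ?ltW //; exact: is_derive1_ln.
have dx := is_derive1_powR s x0.
apply: is_derive_eq; rewrite /GRing.scale /=; field => //.
Qed.

Lemma powR_powint {R : realType} (s x : R) : x `^ s = 1 + s * powint s x.
Proof.
rewrite /powint; have [->|s0] := eqVneq s 0; first by rewrite powRr0; ring.
by field.
Qed.

Lemma powint1 {R : realType} (s : R) : powint s 1 = 0.
Proof. by rewrite /powint ln1 powR1 subrr mul0r if_same. Qed.

(** Change of variables t = x u on the part of the integral from x to xy. *)
Lemma powintM {R : realType} (s x y : R) : 0 < x -> 0 < y ->
  powint s (x * y) = powint s x + x `^ s * powint s y.
Proof.
move=> x0 y0; rewrite /powint; have [->|s0] := eqVneq s 0.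
  by rewrite lnM // powRr0 mul1r.
by rewrite powRM ?ltW //; field.
Qed.

Lemma powintV {R : realType} (s x : R) : 0 < x ->
  powint s x^-1 = - (powint s x / x `^ s).
Proof.
move=> x0; have := powintM s x x^-1 x0; rewrite invr_gt0 => /(_ x0).
rewrite divff ?gt_eqF // powint1 => /esym/eqP; rewrite addr_eq0 => /eqP ->.
by rewrite mulNr opprK mulrC mulKf // gt_eqF // powR_gt0.
Qed.

Lemma powintN {R : realType} (s x : R) : 0 < x ->
  powint (- s) x = powint s x / x `^ s.
Proof.
move=> x0; rewrite /powint oppr_eq0; have [->|s0] := eqVneq s 0.
  by rewrite powRr0 divr1.
by rewrite powRN; field; rewrite s0 gt_eqF // powR_gt0.
Qed.

Lemma powint_gt0 {R : realType} (s x : R) : 1 < x -> 0 < powint s x.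
Proof.
move=> x1; have x0 := lt_trans ltr01 x1.
rewrite /powint; have [_|s0] := eqVneq s 0; first by rewrite ln_gt0.
have := powR_sub1_sign s x x0.
have h : x `^ s != 1 by rewrite powR_eq1 (gt_eqF x1) (lt_gtF x0) (negbTE s0).
rewrite mulrAC pmulr_lge0 ?subr_gt0 // => h0.
have h1 : 0 < s * (x `^ s - 1).
  by rewrite lt_neqAle h0 eq_sym mulf_neq0 // subr_eq0.
rewrite (_ : _ / _ = s * (x `^ s - 1) / s ^+ 2); last by field.
by rewrite divr_gt0 // exprn_even_gt0.
Qed.

Lemma powint_mono {R : realType} (s x y : R) : 0 < x -> x < y ->
  powint s x < powint s y.
Proof.
move=> x0 xy; have y0 := lt_trans x0 xy.
rewrite (_ : y = x * (y / x)); last by field; rewrite gt_eqF.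
rewrite powintM ?divr_gt0 // ltrDl mulr_gt0 ?powR_gt0 // powint_gt0 //.
by rewrite ltr_pdivlMr // mul1r.
Qed.

Lemma weightE {R : realType} (r : R) (n : nat) : (0 < n)%N ->
  weight r n = powint r n.+1%:R - powint r n%:R.
Proof.
move=> n0; rewrite /weight /powint; have [_|r0] := eqVneq r 0.
  by rewrite ln_div ?posrE ?ltr0n.
by field.
Qed.

Lemma weight_gt0 {R : realType} (r : R) (n : nat) : (0 < n)%N ->
  0 < weight r n.
Proof.
by move=> n0; rewrite weightE // subr_gt0 powint_mono ?ltr0n ?ltr_nat.
Qed.

(** * Hoelder's inequality and the Levin-Stechkin comparison *)

(* Hoelder's inequality for [t `^ (r - 1)], the product of powers of
   [t `^ (- c - 1)] and [t `^ (- c)], reversed when [0 < q < 1]. *)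
Lemma hoelder_powint {R : realType} (e q c r a b : R) :
  0 <= e * (q * (q - 1)) -> q * (r - 1 + c) = -1 -> 0 < a -> a < b ->
  0 <= e * (powint (- c) b - powint (- c) a -
    (powint r b - powint r a) `^ q *
    (powint (1 - c) b - powint (1 - c) a) `^ (1 - q)).
Proof.
move=> eq0 qr a0 ab.
set A := powint (- c) b - _; set w := powint r b - _.
set B := powint (1 - c) b - _.
have w0 : 0 < w by rewrite subr_gt0 powint_mono.
have B0 : 0 < B by rewrite subr_gt0 powint_mono.
have z0 : 0 < w / B by rewrite divr_gt0.
pose z := w / B.
(* At slope w/B the tangent is exact at (w, B). The product thus becomes linear in the integrals,
   and a pointwise tangent bound can be integrated. *)
have -> : w `^ q * B `^ (1 - q) = (1 - q) * z `^ q * B + q * z `^ (q - 1) * w.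
  rewrite -(powR_subr1 z q z0) /z powR_divl // !(powR_addr w) // !(powR_addr B) //.
  rewrite !powRN !powRr1 ?ltW //.
  by field; rewrite ?gt_eqF ?powR_gt0.
pose F t := e * (powint (- c) t - (1 - q) * z `^ q * powint (1 - c) t
  - q * z `^ (q - 1) * powint r t).
pose dF t := e * (t `^ (- c - 1) - (1 - q) * z `^ q * t `^ (1 - c - 1)
  - q * z `^ (q - 1) * t `^ (r - 1)).
have FE : e * (A - ((1 - q) * z `^ q * B + q * z `^ (q - 1) * w)) = F b - F a.
  by rewrite /F /A /B /w; ring.
rewrite FE subr_ge0; apply: (@le_of_derive_ge0 _ F dF); first exact: ltW.
  move=> t /andP[at_ _]; have t0 := lt_le_trans a0 at_.
  have d1 := is_derive_powint (- c) t t0.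
  have d2 := is_derive_powint (1 - c) t t0.
  have d3 := is_derive_powint r t t0.
  rewrite /F; apply: is_derive_eq; rewrite /GRing.scale /= /dF; ring.
move=> t /andP[at_ _]; have t0 := lt_le_trans a0 at_.
(* The exponents combine to (r - 1) q - c (1 - q) = - c - 1. *)
have := tangent_homog e q (t `^ (r - 1)) (t `^ (- c)) z eq0.
rewrite !powR_gt0 // => /(_ isT isT z0).
rewrite -!powRrM -powR_addr //.
have -> : (r - 1) * q + - c * (1 - q) = - c - 1.
  have -> : r = q^-1 * -1 + 1 - c.
    rewrite -qr mulKf; first by ring.
    by apply/eqP => q0; move: qr; rewrite q0 mul0r; lra.
  by field; apply/eqP => q0; move: qr; rewrite q0 mul0r; lra.
rewrite /dF (_ : 1 - c - 1 = - c); last by ring.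
by rewrite opprD addrA.
Qed.

(** Compares an integral over [1, x] with the length times the geometric mean of the end values of
    the integrand. The derivative of the difference is a positive multiple of Bernoulli's inequality
    for the exponent -m at 1/t. *)
Lemma powint_midpoint {R : realType} (e s x : R) :
  0 <= e * ((s - 1) * (s + 1)) -> 1 <= x ->
  0 <= e * (powint s x - x `^ ((s - 1) / 2) * (x - 1)).
Proof.
move=> es x1; pose m := (s - 1) / 2.
pose F t := e * (powint s t - t `^ m * (t - 1)).
pose dF t := e * (t `^ (s - 1) - (m * t `^ (m - 1) * (t - 1) + t `^ m)).
have F1 : F 1 = 0 by rewrite /F powint1; ring.
rewrite -/m -/(F x) -F1; apply: (@le_of_derive_ge0 _ F dF) => // t /andP[t1 _].
  have t0 : 0 < t by rewrite (lt_le_trans ltr01).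
  have d1 := is_derive_powint s t t0.
  have d2 := is_derive1_powR m t0.
  rewrite /F; apply: is_derive_eq; rewrite /GRing.scale /= /dF; ring.
have t0 : 0 < t by rewrite (lt_le_trans ltr01).
have tV : 0 < t^-1 by rewrite invr_gt0.
have := bernoulli e (- m) t^-1 _ tV.
have -> : t^-1 `^ (- m) = t `^ m.
  by rewrite powRVl // powRN invrK.
move=> h.
rewrite /dF (_ : s - 1 = m + m); last by rewrite /m; field.
rewrite powR_addr // -(powR_subr1 t m t0).
rewrite (_ : e * _ = t * t `^ (m - 1) * (e * (t `^ m - 1 - - m * (t^-1 - 1)))).
  apply: mulr_ge0; first by rewrite mulr_ge0 ?powR_ge0 ?ltW.
  apply: h; rewrite (_ : _ * _ = 4^-1 * (e * ((s - 1) * (s + 1)))).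
    by rewrite mulr_ge0.
  by rewrite /m; field.
by rewrite -(powR_subr1 t m t0); field; rewrite gt_eqF.
Qed.

(** Up to a positive factor the derivative is a difference of two squares, whose sign is given by
    [powint_midpoint]. *)
Lemma inv_powint_mono {R : realType} (e s x y : R) :
  0 <= e * ((s - 1) * (s + 1)) -> 1 < x -> x <= y ->
  0 <= e * (((powint s y)^-1 - (y - 1)^-1) - ((powint s x)^-1 - (x - 1)^-1)).
Proof.
move=> es x1 xy.
pose F t := e * ((powint s t)^-1 - (t - 1)^-1).
pose dF t := e * ((t - 1) ^- 2 - (powint s t) ^- 2 * t `^ (s - 1)).
rewrite mulrBr -/(F y) -/(F x) subr_ge0.
apply: (@le_of_derive_ge0 _ F dF) => // t /andP[xt _].
  have t1 := lt_le_trans x1 xt; have t0 := lt_trans ltr01 t1.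
  have P0 := powint_gt0 s t t1.
  have d1 := is_derive_powint s t t0.
  have d2 : is_derive t 1 (fun y => (powint s y)^-1)
      (- (powint s t) ^- 2 *: t `^ (s - 1)).
    by apply: is_deriveV; rewrite gt_eqF.
  have d3 : is_derive t 1 (fun y => (y - 1)^-1) (- (t - 1) ^- 2 *: 1).
    have d4 : is_derive t 1 (fun y : R => y - 1) 1.
      by apply: is_derive_eq; rewrite subr0.
    by apply: is_deriveV; rewrite subr_eq0 gt_eqF.
  rewrite /F; apply: is_derive_eq; rewrite /GRing.scale /= /dF; ring.
have t1 := lt_le_trans x1 xt; have t0 := lt_trans ltr01 t1.
have P0 := powint_gt0 s t t1.
have := powint_midpoint e s t es (ltW t1).
rewrite /dF (_ : s - 1 = (s - 1) / 2 + (s - 1) / 2); last by field.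
rewrite powR_addr // (_ : ((s - 1) / 2 + (s - 1) / 2) / 2 = (s - 1) / 2); last by field.
have := powR_gt0 ((s - 1) / 2) t0; set u := t `^ _ => u0 h.
have t10 : 0 < t - 1 by rewrite subr_gt0.
rewrite (_ : e * _ = (e * (powint s t - u * (t - 1))) * ((powint s t + u * (t - 1)) /
   ((t - 1) ^+ 2 * powint s t ^+ 2))); last first.
  by field; rewrite !gt_eqF.
rewrite mulr_ge0 // divr_ge0 //; first by rewrite addr_ge0 ?mulr_ge0 // ltW.
by rewrite mulr_ge0 // sqr_ge0.
Qed.

(* The increments of the right-hand side in the induction proving
   [sum_powR_powint]; rescaled by [x], they compare two values of
   [inv_powint_mono]. *)
Lemma inv_powint_step {R : realType} (e c x : R) :
  0 <= e * (c * (c - 2)) -> 1 < x ->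
  0 <= e * (c * x `^ (c - 1) - ((powint (1 - c) (x + 1) - powint (1 - c) x)^-1 -
                                (powint (1 - c) x - powint (1 - c) (x - 1))^-1)).
Proof.
move=> ec x1; have x0 := lt_trans ltr01 x1.
have x10 : 0 < x - 1 by rewrite subr_gt0.
(* Ratios of consecutive points, for which 1/(y - 1) = x and 1/(z - 1) = x - 1. *)
set s := 1 - c; pose y := (x + 1) / x; pose z := x / (x - 1).
have y1 : 1 < y by rewrite /y ltr_pdivlMr // mul1r ltrDl.
have z1 : 1 < z by rewrite /z ltr_pdivlMr // mul1r gtrBl.
have yz : y <= z.
  rewrite -subr_ge0 (_ : z - y = (x * (x - 1))^-1).
    by rewrite invr_ge0 mulr_ge0 // ltW.
  by rewrite /y /z; field; rewrite !gt_eqF.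
have y0 := lt_trans ltr01 y1; have z0 := lt_trans ltr01 z1.
have -> : powint s (x + 1) - powint s x = x `^ s * powint s y.
  rewrite (_ : x + 1 = x * y); last by rewrite /y; field; rewrite gt_eqF.
  by rewrite powintM //; ring.
have -> : powint s x - powint s (x - 1) = x `^ s * (powint s z / z `^ s).
  rewrite (_ : x - 1 = x * z^-1); last by rewrite /z; field; rewrite !gt_eqF.
  by rewrite powintM ?invr_gt0 // powintV //; ring.
have := inv_powint_mono e s y z.
have -> : (y - 1)^-1 = x by rewrite /y; field; rewrite gt_eqF //=; lra.
have -> : (z - 1)^-1 = x - 1 by rewrite /z; field; rewrite gt_eqF //=; lra.
have Py := powint_gt0 s y y1; have Pz := powint_gt0 s z z1.
rewrite (_ : e * ((s - 1) * (s + 1)) = e * (c * (c - 2))); last by rewrite /s; ring.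
move=> /(_ ec y1 yz) h.
have zs : z `^ s = 1 + s * powint s z by rewrite powR_powint.
have xs := powR_gt0 s x0; have zs0 := powR_gt0 s z0.
have -> : x `^ (c - 1) = (x `^ s)^-1 by rewrite -powRN /s opprB.
rewrite (_ : e * _ = (x `^ s)^-1 *
  (e * ((powint s z)^-1 - (x - 1) - ((powint s y)^-1 - x)))).
  by rewrite mulr_ge0 // invr_ge0 ltW.
have -> : c = 1 - s by rewrite /s; ring.
(* Since z^s = 1 + s P with P = [powint s z], the inverse of P / z^s is s + 1/P; this s completes c
   to 1. *)
have: (x `^ s * (powint s z / z `^ s))^-1 = (x `^ s)^-1 * (s + (powint s z)^-1).
  rewrite invfM invfM invrK zs; congr (_ * _).
  by field; rewrite gt_eqF.
move=> ->; rewrite invfM; ring.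
Qed.

(** The integrand t^(c - 2) is compared with 1 on [1, 2]; this is the base case of the next
    induction. *)
Lemma powint_two {R : realType} (e c : R) :
  0 <= e * (c - 2) -> 0 <= e * (powint (c - 1) 2 - 1).
Proof.
move=> ec; pose F (t : R) := e * (powint (c - 1) t - t).
pose dF (t : R) := e * (t `^ (c - 2) - 1).
suff : F 1 <= F 2 by rewrite /F powint1 -subr_ge0; congr (0 <= _); ring.
have pos (t : R) : 1 <= t <= 2 -> 0 < t.
  by move=> /andP[t1 _]; rewrite (lt_le_trans ltr01).
apply: (@le_of_derive_ge0 _ F dF); first by rewrite ler1n.
  move=> t /pos t0; have d1 := is_derive_powint (c - 1) t t0.
  rewrite /F; apply: is_derive_eq; rewrite /GRing.scale /= /dF.
  by rewrite (_ : c - 1 - 1 = c - 2); ring.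
move=> t /[dup] /pos t0 /andP[t1 _]; rewrite /dF.
by apply: powR_sub1_ge0 => //; rewrite mulr_ge0 // subr_ge0.
Qed.

(* A form of the Levin-Stechkin inequality. *)
Lemma sum_powR_powint {R : realType} (e c : R) (n : nat) :
  0 < c -> 0 <= e * (c - 2) -> (0 < n)%N ->
  0 <= e * (c * (\sum_(1 <= k < n.+1) k%:R `^ (c - 1)) *
     (powint (1 - c) n.+1%:R - powint (1 - c) n%:R) - 1).
Proof.
move=> c0 ec; pose L m := powint (1 - c) m.+1%:R - powint (1 - c) m%:R.
have L0 m : (0 < m)%N -> 0 < L m.
  by move=> m0; rewrite subr_gt0 powint_mono ?ltr0n ?ltr_nat.
(* Dividing by the integral isolates the sum, so that the induction only has to compare
   increments. *)
suff H m : 0 <= e * (c * (\sum_(1 <= k < m.+2) k%:R `^ (c - 1)) - (L m.+1)^-1).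
  case: n => // n _; have := mulr_ge0 (H n) (ltW (L0 n.+1 isT)).
  rewrite -/(L n.+1); congr (0 <= _); rewrite -(mulrA e) mulrBl mulVf //.
  by rewrite gt_eqF // L0.
elim: m => [|m IH].
  rewrite big_nat1 powR1 mulr1 /L powint1 subr0.
  have P0 : 0 < powint (c - 1) 2 by rewrite powint_gt0 // ltr1n.
  have u0 : 0 < (2 : R) `^ (c - 1) by rewrite powR_gt0.
  have h : 0 <= e * (powint (c - 1) 2 - 1) / powint (c - 1) 2.
    by rewrite divr_ge0 ?powint_two // ltW.
  (* With P = [powint (c - 1) 2], the base case reads c - 2^(c - 1) / P = 1 - 1/P. *)
  rewrite -(opprB c 1) powintN ?ltr0n // invf_div (powR_powint (c - 1)).
  apply: le_trans h _; rewrite le_eqVlt; apply/orP/or_introl/eqP.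
  by field; rewrite gt_eqF.
rewrite big_nat_recr //=.
have := inv_powint_step e c m.+2%:R.
rewrite natr1 -(natr1 m.+1) addrK natr1 -/(L m.+2) -/(L m.+1) ltr1n.
rewrite mulrCA mulr_ge0 // ?(ltW c0) // => /(_ isT isT) h.
by apply: le_trans (addr_ge0 IH h) _; rewrite le_eqVlt; apply/orP/or_introl/eqP; ring.
Qed.

(** * Summation by parts *)

Definition sum_pow {R : realType} (c : R) (n : nat) : R :=
  \sum_(1 <= k < n.+1) k%:R `^ (c - 1).

Definition weighted_psum {R : realType} (r : R) (a : nat -> R) (n : nat) : R :=
  \sum_(1 <= k < n.+1) a k / k%:R `^ r.

Lemma sum_nat_gt0 {R : realType} (f : nat -> R) (n : nat) :
  (forall k, (0 < k)%N -> 0 < f k) -> (0 < n)%N ->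
  0 < \sum_(1 <= k < n.+1) f k.
Proof.
move=> f0; elim: n => // n IH _; rewrite big_nat_recr //=.
case: n IH => [_|n IH]; first by rewrite big_nil add0r f0.
by rewrite addr_gt0 ?f0 ?IH.
Qed.

Lemma sum_pow_gt0 {R : realType} (c : R) (n : nat) :
  (0 < n)%N -> 0 < sum_pow c n.
Proof. by apply: sum_nat_gt0 => k k0; rewrite powR_gt0 ?ltr0n. Qed.

Lemma weighted_psum_gt0 {R : realType} (r : R) (a : nat -> R) (n : nat) :
  positive_seq a -> (0 < n)%N -> 0 < weighted_psum r a n.
Proof.
by move=> a0; apply: sum_nat_gt0 => k k0; rewrite divr_gt0 ?powR_gt0 ?ltr0n ?a0.
Qed.

(** Hoelder's inequality brings in B^(1 - q), with B the integral of t^(-c); the Levin-Stechkin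
    inequality raised to the power q - 1 trades it for (c G)^(q - 1). The hypothesis on
    [e * (1 - q) * (c - 2)] makes both steps go the same way. *)
Lemma weight_sum_pow {R : realType} (e q c r : R) (n : nat) :
  0 <= e * (q * (q - 1)) -> 0 <= e * (1 - q) * (c - 2) ->
  q * (r - 1 + c) = -1 -> 0 < c -> (0 < n)%N ->
  0 <= e * (n%:R `^ (- c) - n.+1%:R `^ (- c) -
            c `^ q * weight r n `^ q * sum_pow c n `^ (q - 1)).
Proof.
move=> eq0 ec qr c0 n0.
have n0R : 0 < n%:R :> R by rewrite ltr0n.
have nS : n%:R < n.+1%:R :> R by rewrite ltr_nat.
have := hoelder_powint e q c r _ _ eq0 qr n0R nS.
rewrite -(weightE r n n0); have := powR_gt0 q (weight_gt0 r n n0).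
have B0 : 0 < powint (1 - c) n.+1%:R - powint (1 - c) n%:R.
  by rewrite subr_gt0 powint_mono.
have := sum_powR_powint _ c n c0 ec n0; rewrite -/(sum_pow c n).
move: B0; set B := powint (1 - c) _ - _; set W := weight r n `^ q => B0 key W0.
have -> : powint (- c) n.+1%:R - powint (- c) n%:R =
    c^-1 * (n%:R `^ (- c) - n.+1%:R `^ (- c)).
  by rewrite !powR_powint; field; rewrite gt_eqF.
have G0 := sum_pow_gt0 c n n0; move: G0.
set G := sum_pow c n => G0 hol.
have cG0 : 0 < c * G by rewrite mulr_gt0.
have x0 : 0 < c * G * B by rewrite mulr_gt0.
have : 0 <= - e * ((c * G * B) `^ (q - 1) - 1).
  by apply: powR_sub1_ge0 => //; rewrite mulNr -mulrN opprB.
have Bq : 0 < B `^ (q - 1) by rewrite powR_gt0.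
rewrite (powRM _ (ltW cG0) (ltW B0)) (powRM _ (ltW c0) (ltW G0)) => h.
have h2 : 0 <= W * (- e * (c `^ (q - 1) * G `^ (q - 1) * B `^ (q - 1) - 1) /
    B `^ (q - 1)).
  by rewrite mulr_ge0 ?divr_ge0 // ltW.
have := mulr_ge0 (ltW c0) (addr_ge0 hol h2).
rewrite -(powR_subr1 c q c0) -(opprB q 1) (powRN B).
by congr (0 <= _); field; rewrite !gt_eqF.
Qed.

(** The U_n of the summation by parts, with [weighted_psum] as S_n and [sum_pow] as G_n. *)
Definition potential {R : realType} (q c r : R) (a : nat -> R) (n : nat) : R :=
  weighted_psum r a n `^ q * sum_pow c n `^ (1 - q).

Definition abel_term {R : realType} (q c r : R) (a : nat -> R) (n : nat) : R :=
  (n%:R `^ (- c) - n.+1%:R `^ (- c)) * potential q c r a n.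

Section AbelSummation.
Context {R : realType} (e q c r : R) (a : nat -> R).
Hypothesis eq0 : 0 <= e * (q * (q - 1)).
Hypothesis ec : 0 <= e * (1 - q) * (c - 2).
Hypothesis qr : q * (r - 1 + c) = -1.
Hypothesis c0 : 0 < c.
Hypothesis a0 : positive_seq a.

Local Notation U := (potential q c r a).
Local Notation D := (abel_term q c r a).

Lemma potential_gt0 n : (0 < n)%N -> 0 < U n.
Proof.
by move=> n0; rewrite /potential mulr_gt0 ?powR_gt0 ?weighted_psum_gt0 ?sum_pow_gt0.
Qed.

Lemma term_increment n : (0 < n)%N ->
  0 <= e * (a n.+1 `^ q - n.+1%:R `^ (- c) * (U n.+1 - U n)).
Proof.
move=> n0; set m : R := n.+1%:R.
have m0 : 0 < m by rewrite ltr0n.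
have am : 0 < a n.+1 by exact: a0.
have S0 := weighted_psum_gt0 r a n a0 n0; have G0 := sum_pow_gt0 c n n0.
have d0 : 0 < a n.+1 / m `^ r by rewrite divr_gt0 ?powR_gt0.
have := superadd_homog e q _ _ _ _ eq0 S0 G0 d0 (powR_gt0 (c - 1) m0).
have -> : weighted_psum r a n + a n.+1 / m `^ r = weighted_psum r a n.+1.
  by rewrite /weighted_psum [RHS]big_nat_recr.
have -> : sum_pow c n + m `^ (c - 1) = sum_pow c n.+1.
  by rewrite /sum_pow [RHS]big_nat_recr.
rewrite -/(potential q c r a n) -/(potential q c r a n.+1) => h.
have := mulr_ge0 (powR_ge0 m (- c)) h; congr (0 <= _).
rewrite mulrCA; congr (_ * _); rewrite mulrBr; congr (_ - _).
rewrite powR_divl ?powR_gt0 // -!powRrM.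
(* This exponent identity, equivalent to [qr], leaves exactly the factor n^c on a_n^q. *)
rewrite (_ : (c - 1) * (1 - q) = r * q + c); last by move: qr; lra.
by rewrite powR_addr // powRN; field; rewrite !gt_eqF ?powR_gt0.
Qed.

(** The boundary term is kept because it has the wrong sign for [e = -1]. *)
Lemma sum_abel N : (0 < N)%N ->
  0 <= e * (\sum_(1 <= n < N.+1) a n `^ q -
            (\sum_(1 <= n < N.+1) D n + N.+1%:R `^ (- c) * U N)).
Proof.
case: N => // N _; elim: N => [|N IH].
  (* For a single term there is equality, as U_1 = a_1^q. *)
  rewrite !big_nat1 /abel_term mulrBl subrK powR1 mul1r.
  rewrite /potential /weighted_psum /sum_pow.
  by rewrite !big_nat1 !powR1 divr1 mulr1 subrr mulr0.
rewrite big_nat_recr //= [in X in _ - X]big_nat_recr //=.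
have := addr_ge0 IH (term_increment N.+1 isT).
by congr (0 <= _); rewrite /abel_term; ring.
Qed.

(** This is [weight_sum_pow] multiplied by U_n: the powers of G_n cancel and (w_n S_n)^q remains. *)
Lemma D_weighted_sum n : (0 < n)%N ->
  0 <= e * (D n - c `^ q * weighted_sum r a n `^ q).
Proof.
move=> n0; have := weight_sum_pow e q c r n eq0 ec qr c0 n0.
move/(mulr_ge0 (ltW (potential_gt0 n n0))); congr (0 <= _).
rewrite mulrCA; congr (_ * _); rewrite mulrBr mulrC; congr (_ - _).
rewrite /weighted_sum -/(weighted_psum r a n).
rewrite powRM ?ltW ?weight_gt0 ?weighted_psum_gt0 //.
have G0 := powR_gt0 (1 - q) (sum_pow_gt0 c n n0).
by rewrite /potential -(opprB 1 q) powRN; field; rewrite gt_eqF.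
Qed.

Lemma sum_D_weighted_sum N :
  0 <= e * (\sum_(1 <= n < N.+1) D n -
    c `^ q * \sum_(1 <= n < N.+1) weighted_sum r a n `^ q).
Proof.
rewrite mulr_sumr -sumrB mulr_sumr big_nat_cond sumr_ge0 // => n.
by rewrite andbT => /andP[n0 _]; exact: D_weighted_sum.
Qed.

End AbelSummation.

(** * From partial sums to series: the two inequalities *)

Lemma psum_le_power_series {R : realType} (q : R) (u : nat -> R) (N : nat) :
  ((\sum_(1 <= n < N) u n `^ q)%:E <= power_series_sum q u)%E.
Proof.
rewrite -sumEFin; apply: nneseries_lim_ge => n _ _.
by rewrite lee_fin powR_ge0.
Qed.

Lemma power_series_le {R : realType} (q : R) (u : nat -> R) (N0 : nat) (K : \bar R) :
  (forall N, (N0 <= N)%N -> ((\sum_(1 <= n < N.+1) u n `^ q)%:E <= K)%E) ->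
  (power_series_sum q u <= K)%E.
Proof.
move=> uK; apply: lime_le.
  by apply: is_cvg_nneseries => n _ _; rewrite lee_fin powR_ge0.
near=> N; rewrite sumEFin; have Npos : (0 < N)%N by near: N; exact: nbhs_infty_gt.
rewrite -(prednK Npos) uK // -ltnS prednK //; near: N; exact: nbhs_infty_gt.
Unshelve. all: by end_near. Qed.

Lemma natr_powRN_small {R : realType} (c eps : R) : 0 < c -> 0 < eps ->
  exists M0, forall M, (M0 <= M)%N -> M.+1%:R `^ (- c) < eps.
Proof.
move=> c0 e0; pose K := eps `^ (- c^-1).
exists (Num.trunc K) => M KM.
have K0 : 0 < K by rewrite powR_gt0.
have KM' : K < M.+1%:R by rewrite (lt_le_trans (truncnS_gt K)) // ler_nat.
have := gt0_ltr_powR c0 (ltW K0) (ltW (lt_trans K0 KM')) KM'.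
rewrite /K -powRrM mulNr mulVf ?gt_eqF // powR_inv1 ?ltW // powRN => h.
by rewrite invf_plt // posrE powR_gt0.
Qed.

Lemma upper_weighted {R : realType} (q c r : R) :
  0 <= q * (q - 1) -> 0 <= (1 - q) * (c - 2) ->
  q * (r - 1 + c) = -1 -> 0 < c -> upper_ineq q r (c^-1 `^ q).
Proof.
move=> eq0 ec qr c0 a a0; apply: (@power_series_le _ _ _ 0) => N _.
have cq : 0 < c `^ q by rewrite powR_gt0.
have cV := powRVl c q c0.
apply: (@le_trans _ _ ((c^-1 `^ q)%:E *
  (\sum_(1 <= n < N.+1) a n `^ q)%:E)%E); last first.
  by rewrite lee_pmul2l ?lte_fin ?powR_gt0 ?invr_gt0 ?psum_le_power_series.
rewrite -EFinM lee_fin cV ler_pdivlMl //.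
case: N => [|N]; first by rewrite !big_geq // mulr0.
rewrite -[q * _]mul1r in eq0; rewrite -[1 - q]mul1r in ec.
have := sum_abel 1 q c r a eq0 qr a0 N.+1 isT.
have := sum_D_weighted_sum 1 q c r a eq0 ec qr c0 a0 N.+1.
rewrite !mul1r !subr_ge0 => h1 h2; apply: le_trans h1 _; apply: le_trans h2.
(* For [e = 1] the boundary term is nonnegative and is dropped. *)
by rewrite lerDl mulr_ge0 ?powR_ge0 // ltW // potential_gt0.
Qed.

Lemma potential_mono {R : realType} (q c r : R) (a : nat -> R) (n : nat) :
  0 < q < 1 -> positive_seq a -> (0 < n)%N ->
  potential q c r a n <= potential q c r a n.+1.
Proof.
move=> /andP[q0 q1] a0 n0; have S0 := weighted_psum_gt0 r a n a0 n0.
have G0 := sum_pow_gt0 c n n0.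
have S1 := weighted_psum_gt0 r a n.+1 a0 isT; have G1 := sum_pow_gt0 c n.+1 isT.
rewrite ler_pM ?powR_ge0 //; apply: ge0_ler_powR; rewrite ?nnegrE ?subr_ge0 ?ltW //.
- rewrite /weighted_psum [X in _ < X]big_nat_recr //= ltrDl.
  by rewrite divr_gt0 ?powR_gt0 ?ltr0n // a0.
- by rewrite /sum_pow [X in _ < X]big_nat_recr //= ltrDl powR_gt0.
Qed.

(** As U increases, the tail dominates U_N times a telescoping sum of differences of n^(-c). *)
Lemma abel_term_tail {R : realType} (q c r : R) (a : nat -> R) (N M : nat) :
  0 < q < 1 -> 0 < c -> positive_seq a -> (0 < N <= M)%N ->
  N.+1%:R `^ (- c) * potential q c r a N <=
  \sum_(N.+1 <= n < M.+1) abel_term q c r a n + M.+1%:R `^ (- c) * potential q c r a N.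
Proof.
move=> q01 c0 a0 /andP[N0 NM].
rewrite -(subnKC NM); elim: (M - N)%N => [|k IH].
  by rewrite addn0 big_geq // add0r.
apply: le_trans IH _; rewrite addnS.
rewrite [X in _ <= X + _]big_nat_recr ?ltnS ?leq_addr //= -addrA lerD2l.
rewrite /abel_term; set m := (N + k).+1; rewrite mulrBl addrAC.
have UN : potential q c r a N <= potential q c r a m.
  rewrite /m; elim: k {m} => [|k IH].
    by rewrite addn0 potential_mono.
  by apply: le_trans IH _; rewrite addnS potential_mono.
have le_pow : m.+1%:R `^ (- c) <= m%:R `^ (- c) :> R.
  rewrite !powRN lef_pV2 ?posrE ?powR_gt0 ?ltr0n //.
  by apply: ge0_ler_powR; rewrite ?nnegrE ?ler_nat // ltW.
rewrite -subr_ge0 (_ : _ - _ = (m%:R `^ (- c) - m.+1%:R `^ (- c)) *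
  (potential q c r a m - potential q c r a N)); last by ring.
by rewrite mulr_ge0 ?subr_ge0.
Qed.

Lemma lower_weighted {R : realType} (q c r : R) :
  0 < q < 1 -> 0 < c <= 2 -> q * (r - 1 + c) = -1 -> lower_ineq q r (c^-1 `^ q).
Proof.
move=> q01 /andP[c0 c2] qr a a0; have /andP[q0 q1] := q01.
have eq0 : 0 <= -1 * (q * (q - 1)) by nra.
have ec : 0 <= -1 * (1 - q) * (c - 2) by nra.
have cq : 0 < c `^ q by rewrite powR_gt0.
have cV := powRVl c q c0.
set K := power_series_sum q (weighted_sum r a).
have K0 : (0 <= K)%E by apply: nneseries_ge0 => n _ _; rewrite lee_fin powR_ge0.
have [->|Kfin] := eqVneq K +oo%E; first by rewrite leey.
have KE : K = (fine K)%:E by rewrite fineK // ge0_fin_numE // ltey.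
have weighted_le M : \sum_(1 <= n < M) weighted_sum r a n `^ q <= fine K.
  by rewrite -lee_fin -KE psum_le_power_series.
have partial N : \sum_(1 <= n < N.+1) a n `^ q <= c `^ q * fine K.
  case: N => [|N].
    by rewrite big_geq // mulr_ge0 ?(ltW cq) // -lee_fin -KE.
  have U0 := potential_gt0 q c r a a0 N.+1 isT.
  apply/ler_addgt0Pr => eps eps0.
  have [M0 HM] := natr_powRN_small _ _ c0 (divr_gt0 eps0 U0).
  (* M is so large that the part of the boundary term not absorbed by the tail is below [eps]. *)
  pose M := maxn N.+1 M0; have NM : (0 < N.+1 <= M)%N by rewrite leq_maxl.
  have := HM M (leq_maxr _ _); rewrite ltr_pdivlMr // => small.
  have := sum_abel (-1) q c r a eq0 qr a0 N.+1 isT.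
  have := sum_D_weighted_sum (-1) q c r a eq0 ec qr c0 a0 M.
  have := abel_term_tail q c r a N.+1 M q01 c0 a0 NM.
  have := weighted_le M.+1; rewrite -(ler_pM2l cq).
  (* The sum up to M is cut after index N+1, where the boundary term sits. *)
  rewrite [X in -1 * (X - _)](@big_cat_nat _ _ _ N.+2) //=.
  lra.
have := power_series_le q a 0 (c `^ q * fine K)%:E.
rewrite KE cV => /(_ _)/wrap[|h]; first by move=> N _; rewrite lee_fin.
rewrite muleC lee_pdivrMr // -EFinM mulrC.
exact: h.
Qed.

(** * Optimality: asymptotics of the extremal sequence and divergence *)

Local Open Scope classical_set_scope.

(** The derivative at 1 along the steps s/(n+1): s = 1 serves the weights, s = -1 the backward
    increments of n^c. *)
Lemma cvg_difference_quotient {R : realType} (f : R -> R) (s df : R) :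
  s != 0 -> is_derive (1 : R) 1 f df -> f 1 = 0 ->
  n.+1%:R * f (1 + s / n.+1%:R) @[n --> \oo] --> s * df.
Proof.
move=> s0 fdf f1.
have /cvgr_dnbhsP lim : h^-1 *: ((f \o shift 1) (h *: 1) - f 1) @[h --> (0 : R)^'] --> df.
  by rewrite -(@derive_val _ _ _ _ _ _ _ fdf); exact: (@ex_derive _ _ _ _ _ _ _ fdf).
have harm : s / n.+1%:R @[n --> \oo] --> (0 : R).
  by rewrite -(mulr0 s); apply: cvgMr; exact: cvg_harmonic.
have := lim (fun n => s / n.+1%:R).
have nz n : s / n.+1%:R != 0 by rewrite mulf_neq0 // invr_neq0 // pnatr_eq0.
move=> /(_ (conj nz harm)) h.
have -> : (fun n => n.+1%:R * f (1 + s / n.+1%:R)) =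
   (fun n => s * ((s / n.+1%:R)^-1 *: ((f \o shift 1) ((s / n.+1%:R) *: 1) - f 1))).
  apply/funext => n; rewrite f1 subr0 /= /GRing.scale /= mulr1 addrC.
  by field; rewrite nat1r pnatr_eq0.
exact: cvgMr.
Qed.

(** By scaling, w_n is n^r times the integral over [1, 1 + 1/n]. *)
Lemma cvg_weight {R : realType} (r : R) :
  n.+1%:R `^ (1 - r) * weight r n.+1 @[n --> \oo] --> (1 : R).
Proof.
have d1 := is_derive_powint r 1 (@ltr01 R); rewrite powR1 in d1.
have := cvg_difference_quotient (powint r) 1 1 (oner_neq0 R) d1 (powint1 r).
rewrite mulr1; apply: cvg_trans; apply: near_eq_cvg; near=> n.
have n0 : 0 < n.+1%:R :> R by rewrite ltr0n.
have -> : weight r n.+1 = powint r (n.+1%:R * (1 + 1 / n.+1%:R)) - powint r n.+1%:R.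
  by rewrite weightE // mulrDr mulr1 mul1r divff ?gt_eqF // natr1.
rewrite powintM ?addr_gt0 ?divr_gt0 // [_ + _ - _]addrC addKr mulrA -powR_addr // subrK.
by rewrite powRr1 // ltW.
Unshelve. all: by end_near. Qed.

Lemma cvg_powR_increment {R : realType} (c : R) :
  n.+1%:R `^ (1 - c) * (n.+1%:R `^ c - n%:R `^ c) @[n --> \oo] --> c.
Proof.
have d1 := is_derive1_powR c (@ltr01 R); rewrite powR1 mulr1 in d1.
have d2 : is_derive (1 : R) 1 (fun x => x `^ c - 1) c.
  by apply: is_derive_eq; rewrite subr0.
have N1 : (-1 : R) != 0 by rewrite oppr_eq0 oner_neq0.
have := cvg_difference_quotient _ (-1) _ N1 d2; rewrite powR1 subrr => /(_ erefl).
move=> /cvgN; rewrite mulN1r opprK; apply: cvg_trans; apply: near_eq_cvg; near=> n.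
have n0 : 0 < n.+1%:R :> R by rewrite ltr0n.
have -> : n%:R = n.+1%:R * (1 + -1 / n.+1%:R) :> R.
  by rewrite mulrDr mulr1 mulN1r mulrN divff ?gt_eqF // -natr1 addrK.
(* The base 1 - 1/(n+1) is 0 when n = 0, so only its nonnegativity is used. *)
rewrite powRM ?(ltW n0) //; last first.
  rewrite mulN1r subr_ge0 invf_le1 // ler1n //.
rewrite -[X in _ * (X - _)]mulr1 -mulrBr mulrA -powR_addr // subrK powRr1 ?ltW //.
by rewrite -mulrN opprB.
Unshelve. all: by end_near. Qed.

Lemma cvg_powR_pos {R : realType} (u : nat -> R) (l q : R) :
  0 < l -> u n @[n --> \oo] --> l -> u n `^ q @[n --> \oo] --> l `^ q.
Proof.
move=> l0 ul; have d := is_derive1_powR q l0.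
have /derivable1_diffP/differentiable_continuous cl : derivable (fun x : R => x `^ q) l 1.
  exact: (@ex_derive _ _ _ _ _ _ _ d).
exact: (cvg_comp u (fun x => x `^ q) ul cl).
Qed.

(** Eventually x_n >= l/(2n), so bounded partial sums would make the harmonic series converge. *)
Lemma harmonic_minorant_unbounded {R : realType} (x : nat -> R) (l K : R) :
  0 < l -> n.+1%:R * x n.+1 @[n --> \oo] --> l ->
  exists N, K < \sum_(1 <= n < N.+1) x n.
Proof.
move=> l0 xl; apply: contrapT => /forallNP xK.
have [N0 _ HN0] : \forall n \near \oo, l / 2 <= n.+1%:R * x n.+1.
  apply: (cvgr_ge l xl); lra.
apply: (@dvg_harmonic R).
(* The first N0 harmonic terms, plus what K leaves for the later x_n, divided by l/2. *)
pose B := (K - \sum_(1 <= n < N0.+1) x n) / (l / 2) + series harmonic N0.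
have nd : nondecreasing_seq (series (@harmonic R)).
  apply/nondecreasing_seqP => n.
  by rewrite /series /= big_nat_recr //= lerDl invr_ge0.
apply: nondecreasing_is_cvgn => //; exists B => _ [n _ <-].
apply: (le_trans (nd _ _ (leq_maxl n N0))).
have := leq_maxr n N0; set N := maxn n N0 => NN.
rewrite /B /series /= (@big_cat_nat _ _ _ N0) //= addrC lerD2r ler_pdivlMr ?divr_gt0 //.
rewrite lerBrDl.
have /negP := xK N; rewrite -leNgt; apply: le_trans.
rewrite [X in _ <= X](@big_cat_nat _ _ _ N0.+1) //= lerD2l big_add1 /=.
rewrite mulr_suml; apply: ler_sum_nat => k /andP[Nk _].
by rewrite /= ler_pdivrMl ?ltr0n //; exact: HN0.
Qed.

(* The sequence whose weighted partial sums are exactly [n `^ c]. *)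
Definition extremal {R : realType} (c r : R) (n : nat) : R :=
  n%:R `^ r * (n%:R `^ c - n.-1%:R `^ c).

Lemma extremal_gt0 {R : realType} (c r : R) : 0 < c -> positive_seq (extremal c r).
Proof.
move=> c0 [//|n] _; rewrite mulr_gt0 ?powR_gt0 ?ltr0n // subr_gt0.
by apply: gt0_ltr_powR; rewrite ?nnegrE ?ltr_nat.
Qed.

Lemma weighted_psum_extremal {R : realType} (c r : R) (a : nat -> R) (n : nat) :
  c != 0 -> (forall k, (0 < k <= n)%N -> a k = extremal c r k) ->
  weighted_psum r a n = n%:R `^ c.
Proof.
move=> c0; rewrite /weighted_psum; elim: n => [|n IH] aE.
  (* The empty sum matches 0^c = 0 because [c] is nonzero; 0^0 would be 1. *)
  by rewrite big_geq // powR0.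
rewrite big_nat_recr //= IH; last first.
  by move=> k /andP[k0 kn]; rewrite aE // k0 ltnW.
rewrite aE ?leqnn // /extremal /= mulrAC divff ?mul1r ?gt_eqF ?powR_gt0 ?ltr0n //.
by ring.
Qed.

Lemma extremal_unbounded {R : realType} (e q c r C' K : R) :
  q * (r - 1 + c) = -1 -> 0 < c -> 0 < e * (1 - C' * c `^ q) ->
  exists N, K < e * (\sum_(1 <= n < N.+1) (weight r n * n%:R `^ c) `^ q -
                     C' * \sum_(1 <= n < N.+1) extremal c r n `^ q).
Proof.
move=> qr c0 eC.
pose x n := e * ((weight r n * n%:R `^ c) `^ q - C' * extremal c r n `^ q).
have [|N HN] := @harmonic_minorant_unbounded _ x _ K eC; last first.
  exists N; apply: (lt_le_trans HN).
  by rewrite mulr_sumr -sumrB mulr_sumr.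
have wl := cvg_powR_pos _ _ q (@ltr01 R) (cvg_weight r).
have il := cvg_powR_pos _ _ q c0 (cvg_powR_increment c).
rewrite powR1 in wl.
have : e * ((n.+1%:R `^ (1 - r) * weight r n.+1) `^ q -
    C' * (n.+1%:R `^ (1 - c) * (n.+1%:R `^ c - n%:R `^ c)) `^ q)
    @[n --> \oo] --> e * (1 - C' * c `^ q).
  by apply: cvgMr; apply: cvgB wl _; exact: cvgMr.
apply: cvg_trans; apply: near_eq_cvg; near=> n.
have n0 : 0 < n.+1%:R :> R by rewrite ltr0n.
have w0 := weight_gt0 r n.+1 isT.
have d0 : 0 < n.+1%:R `^ c - n%:R `^ c :> R.
  by rewrite subr_gt0 gt0_ltr_powR ?nnegrE ?ltr_nat.
rewrite /x /extremal /= mulrCA; congr (_ * _).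
rewrite [RHS]mulrBr [n.+1%:R * (C' * _)]mulrCA; congr (_ - _ * _).
all: rewrite !powRM ?powR_ge0 ?(ltW w0) ?(ltW d0) //.
  (* By [qr], the factor n enters the q-th powers: n n^(cq) = n^((1-r)q) here, and n n^(rq) =
     n^((1-c)q) below. *)
  rewrite -powRrM (_ : (1 - r) * q = 1 + c * q); last by move: qr; lra.
  by rewrite powR_addr // powRr1 ?(ltW n0) // -powRrM; ring.
rewrite -powRrM (_ : (1 - c) * q = 1 + r * q); last by move: qr; lra.
by rewrite powR_addr // powRr1 ?(ltW n0) // -powRrM; ring.
Unshelve. all: by end_near. Qed.

Lemma upper_weighted_optimal {R : realType} (q c r C' : R) :
  q != 0 -> q * (r - 1 + c) = -1 -> 0 < c -> C' < c^-1 `^ q ->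
  ~ upper_ineq q r C'.
Proof.
(* Passing to a nonnegative constant weakens the inequality and lets upper bounds be multiplied by
   it. *)
move=> q0 qr c0 C'lt H; pose C2 := Num.max C' 0.
have cq : 0 < c `^ q by rewrite powR_gt0.
have C2lt : C2 < c^-1 `^ q by rewrite gt_max C'lt powR_gt0 // invr_gt0.
have C20 : 0 <= C2 by rewrite le_max lexx orbT.
have eC : 0 < 1 * (1 - C2 * c `^ q).
  by rewrite mul1r subr_gt0 -ltr_pdivlMr // div1r -powRVl.
(* The excess [C2] pays for the tail, whose q-th powers sum to at most 1. *)
have [N HN] := extremal_unbounded 1 q c r C2 C2 qr c0 eC.
(* The tail has q-th powers 2^(-n), whatever the sign of q. *)
pose a n := if (n <= N)%N then extremal c r n else 2 `^ (- n%:R / q).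
have a0 : positive_seq a.
  by move=> n n0; rewrite /a; case: ifP => _; rewrite ?powR_gt0 ?extremal_gt0.
have aN n : (n <= N)%N -> a n = extremal c r n by rewrite /a => ->.
have Sa : (power_series_sum q a <= (\sum_(1 <= n < N.+1) extremal c r n `^ q + 1)%:E)%E.
  apply: (@power_series_le _ _ _ N) => M NM; rewrite lee_fin -(subnKC NM).
  suff : \sum_(1 <= n < (N + (M - N)).+1) a n `^ q <=
    \sum_(1 <= n < N.+1) extremal c r n `^ q + 1 - 2 `^ (- (N + (M - N))%:R).
    by move=> h; apply: (le_trans h); rewrite gerBl powR_ge0.
  elim: (M - N)%N => [|k IH].
    rewrite addn0 (eq_big_nat _ _ (F2 := fun n => extremal c r n `^ q)).
      rewrite -addrA lerDl subr_ge0 powRN invf_le1 ?powR_gt0 //.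
      by rewrite -[X in X <= _](powRr0 2) ler_powR // ler1n.
    by move=> n /andP[_ nN]; rewrite aN.
  rewrite addnS big_nat_recr //= {2}/a ifN -?ltnNge ?ltnS ?leq_addr //.
  rewrite -powRrM divfK //.
  have two : 2 `^ (- (N + k)%:R) = 2 * 2 `^ (- (N + k).+1%:R) :> R.
    rewrite -[X in X * _]powRr1 // -powR_addr //; congr powR.
    by rewrite -natr1; ring.
  move: IH two; lra.
have Wa : ((\sum_(1 <= n < N.+1) (weight r n * n%:R `^ c) `^ q)%:E <=
   power_series_sum q (weighted_sum r a))%E.
  apply: le_trans (psum_le_power_series _ _ N.+1).
  rewrite lee_fin le_eqVlt; apply/orP/or_introl/eqP/eq_big_nat => n /andP[n0 nN].
  rewrite /weighted_sum -/(weighted_psum r a n) (weighted_psum_extremal c) ?gt_eqF //.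
  by move=> k /andP[_ kn]; rewrite aN // (leq_trans kn).
have /(le_trans Wa) := H a a0.
have pa0 : (0 <= power_series_sum q a)%E.
  by apply: nneseries_ge0 => n _ _; rewrite lee_fin powR_ge0.
have C2a : (C'%:E * power_series_sum q a <= C2%:E * power_series_sum q a)%E.
  by rewrite lee_wpmul2r // lee_fin le_max lexx.
move=> /le_trans/(_ C2a) h.
have C2b : (C2%:E * power_series_sum q a <=
    C2%:E * (\sum_(1 <= n < N.+1) extremal c r n `^ q + 1)%:E)%E.
  by rewrite lee_wpmul2l // lee_fin.
have := le_trans h C2b; rewrite -EFinM lee_fin.
move: HN; rewrite mul1r mulrDr mulr1; lra.
Qed.

(** For s <= 1 the integrand t^(s - 1) is nonincreasing, so its end values bound the integral over a
    unit interval. *)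
Lemma powint_increment_bounds {R : realType} (s x : R) : s <= 1 -> 0 < x ->
  (x + 1) `^ (s - 1) <= powint s (x + 1) - powint s x <= x `^ (s - 1).
Proof.
move=> s1 x0; have x1 : x <= x + 1 by rewrite lerDl.
have dec (t u : R) : 0 < t -> t <= u -> u `^ (s - 1) <= t `^ (s - 1).
  move=> t0 tu; have u0 := lt_le_trans t0 tu.
  rewrite -(opprB 1 s) !powRN lef_pV2 ?posrE ?powR_gt0 //.
  by apply: ge0_ler_powR; rewrite ?nnegrE ?subr_ge0 ?(ltW t0) ?(ltW u0).
apply/andP; split.
  pose F t := powint s t - (x + 1) `^ (s - 1) * t.
  suff : F x <= F (x + 1) by rewrite /F; lra.
  apply: (@le_of_derive_ge0 _ F (fun t => t `^ (s - 1) - (x + 1) `^ (s - 1))) => //.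
    move=> t /andP[xt _]; have d := is_derive_powint s t (lt_le_trans x0 xt).
    by rewrite /F; apply: is_derive_eq; rewrite /GRing.scale /= mulr1.
  by move=> t /andP[xt tx]; rewrite subr_ge0 dec // (lt_le_trans x0).
pose F t := x `^ (s - 1) * t - powint s t.
suff : F x <= F (x + 1) by rewrite /F; lra.
apply: (@le_of_derive_ge0 _ F (fun t => x `^ (s - 1) - t `^ (s - 1))) => //.
  move=> t /andP[xt _]; have d := is_derive_powint s t (lt_le_trans x0 xt).
  by rewrite /F; apply: is_derive_eq; rewrite /GRing.scale /= mulr1.
by move=> t /andP[xt tx]; rewrite subr_ge0 dec.
Qed.

Lemma lower_weighted_optimal {R : realType} (q c r C' : R) :
  0 < q < 1 -> q * (r - 1 + c) = -1 -> 0 < c -> c^-1 `^ q < C' ->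
  ~ lower_ineq q r C'.
Proof.
move=> /andP[q0 q1] qr c0 C'gt H.
have cq : 0 < c `^ q by rewrite powR_gt0.
have C'0 : 0 < C' by rewrite (lt_trans _ C'gt) // powR_gt0 // invr_gt0.
pose s := c * q; have s0 : 0 < s by rewrite mulr_gt0.
have rq : (r - 1) * q = - s - 1 by move: qr; rewrite /s; lra.
have r1 : r <= 1 by nra.
(* K bounds the tail of the left-hand series uniformly in N, which is chosen only afterwards. *)
pose K := 2 `^ q / s; have K0 : 0 < K by rewrite divr_gt0 ?powR_gt0.
have eC : 0 < -1 * (1 - C' * c `^ q).
  by rewrite mulN1r opprB subr_gt0 -ltr_pdivrMr // div1r -powRVl.
have [[|N'] HN] := extremal_unbounded (-1) q c r C' K qr c0 eC.
  (* N = 0 is impossible: empty sums give no excess over K > 0. *)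
  by move: HN; rewrite !big_geq // mulr0 subrr mulr0 ltNge (ltW K0).
set N := N'.+1 in HN *.
have N0 : 0 < N%:R :> R by rewrite ltr0n.
have Nc1 : 1 <= N%:R `^ c :> R.
  by rewrite -[X in X <= _](powRr0 N%:R) ler_powR ?ler1n // ltW.
(* Beyond N, S_n grows by 2^(-n), hence by at most 1 <= N^c in total. *)
pose a n := if (n <= N)%N then extremal c r n else n%:R `^ r * 2 `^ (- n%:R).
have a0 : positive_seq a.
  move=> n n0; rewrite /a; case: ifP => _; first exact: extremal_gt0.
  by rewrite mulr_gt0 ?powR_gt0 ?ltr0n.
have aN n : (n <= N)%N -> a n = extremal c r n by rewrite /a => ->.
have psumN n : (n <= N)%N -> weighted_psum r a n = n%:R `^ c.
  move=> nN; apply: weighted_psum_extremal; first by rewrite gt_eqF.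
  by move=> k /andP[_ kn]; rewrite aN // (leq_trans kn).
have psum_le k : weighted_psum r a (N + k) <= 2 * N%:R `^ c.
  suff : weighted_psum r a (N + k) <= N%:R `^ c + 1 - 2 `^ (- (N + k)%:R).
    by have := powR_ge0 2 (- (N + k)%:R : R); move: Nc1; lra.
  elim: k => [|k IH].
    rewrite addn0 psumN // -addrA lerDl subr_ge0 powRN invf_le1 ?powR_gt0 //.
    by rewrite -[X in X <= _](powRr0 2) ler_powR // ler1n.
  rewrite addnS /weighted_psum big_nat_recr //= -/(weighted_psum r a (N + k)).
  rewrite {2}/a ifN -?ltnNge ?ltnS ?leq_addr // mulrAC divff ?mul1r; last first.
    by rewrite gt_eqF // powR_gt0 // ltr0n.
  have two : 2 `^ (- (N + k)%:R) = 2 * 2 `^ (- (N + k).+1%:R) :> R.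
    rewrite -[X in X * _]powRr1 // -powR_addr //; congr powR.
    by rewrite -natr1; ring.
  by move: IH two; lra.
have term_le k : weighted_sum r a (N + k).+1 `^ q <=
    (2 * N%:R `^ c) `^ q * (powint (- s) (N + k).+1%:R - powint (- s) (N + k)%:R).
  set m : R := (N + k).+1%:R; have m0 : 0 < m by rewrite ltr0n.
  have m10 : 0 < (N + k)%:R :> R by rewrite ltr0n.
  have w0 := weight_gt0 r (N + k).+1 isT.
  have w1 : weight r (N + k).+1 <= m `^ (r - 1).
    rewrite weightE // -natr1; by case/andP: (powint_increment_bounds r m r1 m0).
  have S0 := weighted_psum_gt0 r a (N + k).+1 a0 isT.
  have := psum_le k.+1; rewrite addnS => S1.
  apply: (@le_trans _ _ ((2 * N%:R `^ c) `^ q * m `^ (- s - 1))).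
    rewrite -rq [m `^ _]powRrM -powRM ?mulr_ge0 ?powR_ge0 //.
    rewrite mulrC; apply: ge0_ler_powR;
      rewrite ?nnegrE ?mulr_ge0 ?powR_ge0 ?(ltW q0) ?(ltW w0) //.
      exact: ltW.
    by rewrite /weighted_sum ler_pM // ltW.
  rewrite ler_wpM2l ?powR_ge0 //.
  have sN : - s <= 1 by lra.
  (* The value at the right end is at most the integral over the preceding unit interval, so the
     bounds telescope. *)
  by have /andP[+ _] := powint_increment_bounds (- s) _ sN m10; rewrite natr1.
have Wa : (power_series_sum q (weighted_sum r a) <=
   (\sum_(1 <= n < N.+1) (weight r n * n%:R `^ c) `^ q + K)%:E)%E.
  apply: (@power_series_le _ _ _ N) => M NM; rewrite lee_fin -(subnKC NM).
  have tail k : \sum_(1 <= n < (N + k).+1) weighted_sum r a n `^ q <=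
    \sum_(1 <= n < N.+1) (weight r n * n%:R `^ c) `^ q +
    (2 * N%:R `^ c) `^ q * (powint (- s) (N + k)%:R - powint (- s) N%:R).
    elim: k => [|k IH].
      rewrite addn0 subrr mulr0 addr0 le_eqVlt; apply/orP/or_introl/eqP/eq_big_nat.
      move=> n /andP[_ nN]; rewrite /weighted_sum -/(weighted_psum r a n) psumN //.
    rewrite addnS big_nat_recr //=; have := term_le k; move: IH; lra.
  apply: (le_trans (tail _)); rewrite lerD2l.
  (* The factor N^s from S_n^q cancels the N^(-s) of the tail integral, leaving K. *)
  rewrite powRM ?powR_ge0 // -powRrM -/s /K -mulrA ler_wpM2l ?powR_ge0 //.
  have Ns : 0 < N%:R `^ s :> R by rewrite powR_gt0.
  have -> : powint (- s) (N + (M - N))%:R - powint (- s) N%:R =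
      (N%:R `^ (- s) - (N + (M - N))%:R `^ (- s)) / s.
    by rewrite !powR_powint; field; rewrite gt_eqF.
  rewrite mulrA -[X in _ <= X]mul1r ler_pM2r ?invr_gt0 // mulrBr.
  rewrite [N%:R `^ (- s)]powRN divff ?gt_eqF //.
have := H a a0 => h; have := le_trans h Wa.
have C'a : (C'%:E * (\sum_(1 <= n < N.+1) extremal c r n `^ q)%:E <=
    C'%:E * power_series_sum q a)%E.
  rewrite lee_wpmul2l ?lee_fin ?(ltW C'0) //.
  apply: le_trans (psum_le_power_series _ _ N.+1).
  rewrite lee_fin le_eqVlt; apply/orP/or_introl/eqP/eq_big_nat => n /andP[_ nN].
  by rewrite aN.
move=> /(le_trans C'a); rewrite -EFinM lee_fin.
by move: HN; lra.
Qed.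

Theorem theorem1p2 (R : realType) (p q r : R) (hpq : p^-1 + q^-1 = 1) :
  (0 < p < 1 -> (2 + r) * p <= 1 ->
     best_upper q r ((p / (1 - r * p)) `^ q)) /\
  (1 < p -> p^-1 - 2 <= r < p^-1 ->
     best_upper q r ((p / (1 - r * p)) `^ q)) /\
  (p < 0 -> p^-1 - 2 <= r < p^-1 ->
     best_lower q r ((p / (1 - r * p)) `^ q)).
Proof.
pose c := p^-1 - r.
have CE : p != 0 -> p / (1 - r * p) = c^-1.
  move=> p0; rewrite (_ : c = (1 - r * p) / p) ?invf_div //.
  by rewrite /c; field.
have qE : q^-1 = 1 - p^-1 by rewrite -hpq addrC addKr.
have qr : q != 0 -> q * (r - 1 + c) = -1.
  move=> q0; rewrite (_ : r - 1 + c = - q^-1); last by rewrite qE /c; ring.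
  by rewrite mulrN divff.
split; [|split].
- move=> /andP[p0 p1] rp.
  have pV : 1 < p^-1 by rewrite invf_gt1.
  have q0 : q < 0 by rewrite -invr_lt0 qE; lra.
  (* Here q < 0, so 1 - q > 0 and the convex case needs c >= 2, which is (2 + r) p <= 1. *)
  have c2 : 2 <= c by rewrite /c lerBrDr -ler_pdivlMr // in rp *; move: rp; rewrite div1r.
  rewrite CE ?gt_eqF //; have c0 : 0 < c by lra.
  have qr' : q * (r - 1 + c) = -1 by rewrite qr // lt_eqF.
  split; first by apply: upper_weighted => //; nra.
  by move=> C' C'lt; apply: (upper_weighted_optimal q c) => //; rewrite lt_eqF.
- move=> p1 /andP[r0 r1]; have p0 : 0 < p by lra.
  have pV : 0 < p^-1 < 1 by rewrite invr_gt0 p0 invf_lt1.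
  have q0 : 0 < q by rewrite -invr_gt0 qE; lra.
  have q1 : 1 < q by rewrite -[q]invrK invf_gt1 ?invr_gt0 // qE; lra.
  rewrite CE ?gt_eqF //; have c0 : 0 < c by rewrite /c; lra.
  (* Now q > 1 makes 1 - q negative, and the convex case needs c <= 2 instead. *)
  have c2 : c <= 2 by rewrite /c; lra.
  have qr' : q * (r - 1 + c) = -1 by rewrite qr // gt_eqF.
  split; first by apply: upper_weighted => //; nra.
  by move=> C' C'lt; apply: (upper_weighted_optimal q c) => //; rewrite gt_eqF.
- move=> p0 /andP[r0 r1]; have pV : p^-1 < 0 by rewrite invr_lt0.
  have q0 : 0 < q by rewrite -invr_gt0 qE; lra.
  have q01 : 0 < q < 1 by rewrite q0 -[q]invrK invf_lt1 ?invr_gt0 // qE; lra.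
  rewrite CE ?lt_eqF //; have c0 : 0 < c by rewrite /c; lra.
  have c2 : c <= 2 by rewrite /c; lra.
  have qr' : q * (r - 1 + c) = -1 by rewrite qr // gt_eqF.
  split; first by apply: lower_weighted => //; rewrite c0.
  by move=> C' C'gt; exact: (lower_weighted_optimal q c).
Qed.
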